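(* Let $\mathcal{A}$ be an $n$-dimensional evolution algebra over a field $\mathbb{K}$ with natural basis $\mathcal{B}=\{e_1,\dots,e_n\}$ and structure constants $w_{ki}$. A triple of linear maps $(d_1,d_2,d_3)$ on $\mathcal{A}$, with $d_\ell(e_i)=\sum_{k=1}^n d^{(\ell)}_{ki}e_k$ for $\ell=1,2,3$, is a ternary derivation of $\mathcal{A}$ if and only if $$w_{ki}d^{(2)}_{ij}+w_{kj}d^{(3)}_{ji}=0\quad\text{for all } k,i,j\in\{1,\dots,n\}\text{ with } i\neq j,$$ and $$\sum_{k=1}^n w_{ki}d^{(1)}_{jk}=\big(d^{(2)}_{ii}+d^{(3)}_{ii}\big)w_{ji}\quad\text{for all } i,j\in\{1,\dots,n\}.$$
   Context: $\mathbb{K}$ is an arbitrary field. An $n$-dimensional evolution algebra is an $n$-dimensional vector space $\mathcal{A}$ over $\mathbb{K}$ with a bilinear product admitting a basis $\mathcal{B}=\{e_1,\dots,e_n\}$ (a natural basis) such that $e_ie_j=0$ for $i\neq j$; the structure constants $w_{ki}$ are defined by $e_i^2=\sum_{k=1}^n w_{ki}e_k$. A ternary derivation of $\mathcal{A}$ is a triple $(d_1,d_2,d_3)$ of linear maps $\mathcal{A}\to\mathcal{A}$ with $d_1(xy)=d_2(x)y+xd_3(y)$ for all $x,y\in\mathcal{A}$. *)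

(* Defs.v *)
From mathcomp Require Import all_boot all_order all_algebra.

Set Implicit Arguments.
Unset Strict Implicit.
Unset Printing Implicit Defensive.

Import GRing.Theory.
Local Open Scope ring_scope.

(* A finite-dimensional, not necessarily associative or unital, K-algebra is a
   [vectType K] together with an arbitrary bilinear product [mul]. It is an
   n-dimensional evolution algebra when it admits a natural basis of length n. *)
Definition natural_basis (K : fieldType) (A : vectType K)
    (mul : {bilinear A -> A -> A}) (n : nat) (e : n.-tuple A) : Prop :=
  basis_of fullv e /\ forall i j : 'I_n, i != j -> mul e`_i e`_j = 0.

Definition ternary_derivation (K : fieldType) (A : vectType K)
    (mul : {bilinear A -> A -> A}) (d1 d2 d3 : {linear A -> A}) : Prop :=
  forall x y : A, d1 (mul x y) = mul (d2 x) y + mul x (d3 y).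

(* Main.v *)
Require Import Defs.
From mathcomp Require Import all_boot all_order all_algebra.

Import GRing.Theory.
Local Open Scope ring_scope.

(** Both sides of the identity [d1 (x y) = (d2 x) y + x (d3 y)] are bilinear in
    [(x, y)], so the identity holds everywhere as soon as it holds on the pairs
    [(e_j, e_i)] of basis vectors ([ternary_derivation_basisP]).  Orthogonality
    of the natural basis means that right multiplication by [e_i] sees only the
    [e_i]-component of its argument, whence
    [(d2 e_j) e_i + e_j (d3 e_i) = D2 i j * e_i^2 + D3 j i * e_j^2].
    For [j != i] the left-hand side [d1 (e_j e_i)] vanishes, and for [j = i] it
    is [d1 (e_i^2)], which is expanded through the structure constants.
    Comparing coordinates in the basis gives the first family of equations in
    the off-diagonal case and the second family in the diagonal case. *)

Lemma free_sum_eqP (K : fieldType) (A : vectType K) (n : nat) (e : n.-tuple A)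
    (a b : 'I_n -> K) :
  free e ->
  \sum_(k < n) a k *: e`_k = \sum_(k < n) b k *: e`_k <->
  (forall k, a k = b k).
Proof.
move=> fe; split=> [ab k | ab]; last by apply: eq_bigr => k _; rewrite ab.
by rewrite -(coord_sum_free a k fe) ab coord_sum_free.
Qed.

Arguments free_sum_eqP {K A n e a b}.

Lemma ternary_derivation_basisP (K : fieldType) (A : vectType K)
    (mul : {bilinear A -> A -> A}) (n : nat) (e : n.-tuple A)
    (d1 d2 d3 : {linear A -> A}) :
  basis_of fullv e ->
  ternary_derivation mul d1 d2 d3 <->
  (forall i j : 'I_n,
     d1 (mul e`_i e`_j) = mul (d2 e`_i) e`_j + mul e`_i (d3 e`_j)).
Proof.
move=> be; split=> [dP i j | dP x y]; first exact: dP.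
rewrite (coord_basis be (memvf x)) (coord_basis be (memvf y)).
rewrite !linear_sumlz (linear_sum d1) (linear_sum d2) linear_sumlz -big_split.
apply: eq_bigr => i _ /=.
rewrite (linear_sum d3) !linear_sumr (linear_sum d1) -big_split.
apply: eq_bigr => j _ /=.
by rewrite !linearZ /= !linearZl_LR /= !linearZ /= dP !scalerDr.
Qed.

Arguments ternary_derivation_basisP {K A mul n e d1 d2 d3}.

Lemma natural_basis_mulr (K : fieldType) (A : vectType K)
    (mul : {bilinear A -> A -> A}) (n : nat) (e : n.-tuple A)
    (he : natural_basis mul e) (a : 'I_n -> K) (i : 'I_n) :
  mul (\sum_(k < n) a k *: e`_k) e`_i = a i *: mul e`_i e`_i.
Proof.
rewrite linear_sumlz (bigD1 i) //= big1 ?addr0 ?linearZl_LR // => k ki.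
by rewrite linearZl_LR /= he.2 ?scaler0.
Qed.

Lemma natural_basis_mull (K : fieldType) (A : vectType K)
    (mul : {bilinear A -> A -> A}) (n : nat) (e : n.-tuple A)
    (he : natural_basis mul e) (a : 'I_n -> K) (i : 'I_n) :
  mul e`_i (\sum_(k < n) a k *: e`_k) = a i *: mul e`_i e`_i.
Proof.
rewrite linear_sumr (bigD1 i) //= big1 ?addr0 ?linearZ // => k ki.
by rewrite linearZ /= he.2 ?scaler0 // eq_sym.
Qed.

Theorem proposition4p1 (K : fieldType) (A : vectType K)
    (mul : {bilinear A -> A -> A}) (n : nat) (e : n.-tuple A)
    (he : natural_basis mul e)
    (w : 'M[K]_n)
    (hw : forall i : 'I_n, mul e`_i e`_i = \sum_(k < n) w k i *: e`_k)
    (d1 d2 d3 : {linear A -> A}) (D1 D2 D3 : 'M[K]_n)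
    (hD1 : forall i : 'I_n, d1 e`_i = \sum_(k < n) D1 k i *: e`_k)
    (hD2 : forall i : 'I_n, d2 e`_i = \sum_(k < n) D2 k i *: e`_k)
    (hD3 : forall i : 'I_n, d3 e`_i = \sum_(k < n) D3 k i *: e`_k) :
  ternary_derivation mul d1 d2 d3 <->
  (forall k i j : 'I_n, i != j -> w k i * D2 i j + w k j * D3 j i = 0) /\
  (forall i j : 'I_n,
     \sum_(k < n) w k i * D1 j k = (D2 i i + D3 i i) * w j i).
Proof.
have fe : free e := basis_free he.1.
have rhsE (i j : 'I_n) : mul (d2 e`_j) e`_i + mul e`_j (d3 e`_i)
    = \sum_(k < n) (w k i * D2 i j + w k j * D3 j i) *: e`_k.
  rewrite hD2 hD3 natural_basis_mulr // natural_basis_mull // !hw.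
  rewrite !scaler_sumr -big_split; apply: eq_bigr => k _ /=.
  by rewrite !scalerA -scalerDl ![w _ _ * _]mulrC.
have d1_sqr (i : 'I_n) : d1 (mul e`_i e`_i)
    = \sum_(j < n) (\sum_(k < n) w k i * D1 j k) *: e`_j.
  under [RHS]eq_bigr => j _ do rewrite scaler_suml.
  rewrite exchange_big hw linear_sum; apply: eq_bigr => k _ /=.
  rewrite linearZ hD1 /= scaler_sumr.
  by apply: eq_bigr => j _; rewrite scalerA.
have diagE i j : w j i * D2 i i + w j i * D3 i i = (D2 i i + D3 i i) * w j i.
  by rewrite -mulrDr mulrC.
(* The zero vector is written in coordinates so that the off-diagonal case is
   again a comparison of two expansions. *)
have sum0 : \sum_(k < n) (0 : K) *: e`_k = 0.
  by rewrite big1 // => k _; rewrite scale0r.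
split=> [/(ternary_derivation_basisP he.1) dP | [offdiag diag]].
  split=> [k i j ij | i j].
    have := dP j i; rewrite rhsE he.2 1?eq_sym // linear0 -[LHS]sum0.
    by move/(free_sum_eqP fe)/(_ k).
  have := dP i i; rewrite rhsE d1_sqr => /(free_sum_eqP fe)/(_ j) ->.
  exact: diagE.
apply/(ternary_derivation_basisP he.1) => j i; rewrite rhsE.
have [<-|ij] := eqVneq i j.
  by rewrite d1_sqr; apply/(free_sum_eqP fe) => k; rewrite diag diagE.
rewrite he.2 1?eq_sym // linear0 -[LHS]sum0.
by apply/(free_sum_eqP fe) => k; rewrite offdiag.
Qed.
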